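(* For every integer $n\geq 2$, the directed graph $n\overrightarrow{C_3}$ has a graceful difference labeling with at most one arc of magnitude $3n-2$, and with all other arcs of magnitude strictly smaller than $3n-2$.
   Context: A graceful difference labeling (gdl) of a finite directed graph $G=(V,A)$ is a bijection $f:V\rightarrow\{1,\ldots,|V|\}$ such that, when each arc $uv\in A$ (from $u$ to $v$) is assigned the difference label $f(v)-f(u)$, the resulting arc labels are pairwise distinct. The magnitude of an arc $uv$ (with respect to $f$) is $|f(v)-f(u)|$. $\overrightarrow{C_3}$ is the directed triangle with vertex set $\{v_1,v_2,v_3\}$ and arc set $\{v_1v_2,v_2v_3,v_3v_1\}$, and $n\overrightarrow{C_3}$ denotes the disjoint union of $n$ copies of $\overrightarrow{C_3}$ (so it has $3n$ vertices and $3n$ arcs). *)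

(* Defs.v *)
From mathcomp Require Import all_boot all_order all_algebra.
Set Implicit Arguments.
Unset Strict Implicit.
Unset Printing Implicit Defensive.

Record digraph := Digraph { vertex : finType; arcs : {set vertex * vertex} }.

(** The vertices v_1, v_2, v_3 are 0, 1, 2 : 'I_3. *)
Definition dicycle3 : digraph :=
  @Digraph 'I_3 [set (0%R, 1%R); (1%R, 2%:R%R); (2%:R%R, 0%R)].

(** The vertex (i, v) is the vertex v of the i-th copy of G. *)
Definition copies (n : nat) (G : digraph) : digraph :=
  @Digraph ('I_n * vertex G)%type
    [set a | (a.1.1 == a.2.1) && ((a.1.2, a.2.2) \in arcs G)].

Section GracefulDifferenceLabeling.
Variables (G : digraph) (f : vertex G -> nat).
Implicit Type a : vertex G * vertex G.

Definition arc_label a : int := ((f a.2)%:Z - (f a.1)%:Z)%R.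

Definition magnitude a : nat := `|arc_label a|%N.

(** The first two conditions say that f is a bijection onto {1, ..., #|V|}. *)
Definition gdl : Prop :=
  [/\ injective f,
      forall k : nat, (exists v, f v = k) <-> 1 <= k <= #|vertex G|
    & {in arcs G &, injective arc_label}].

End GracefulDifferenceLabeling.

(* Main.v *)
Require Import Defs.
From mathcomp Require Import all_boot all_order all_algebra.
From mathcomp Require Import zify.
Set Implicit Arguments.
Unset Strict Implicit.
Unset Printing Implicit Defensive.

(** Write n = 4m + r with r < 4.  For fixed r, the vertex labels are given by
    four families of m triangles whose labels are affine in the index i < m,
    with slopes 1, -1, 2 along the three vertices, together with r exceptional
    triangles whose labels are affine in m.  The labels of the families fill ten
    consecutive blocks, two of which are shared by two families according to
    parity, and the exceptional labels sit in the gaps around these blocks.  The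
    conditions on the labeling are then linear arithmetic in m and the indices:
    arc labels of two families with overlapping ranges are separated modulo 2
    or 3.  All magnitudes are in fact strictly smaller than 3n - 2.  The
    families were found by a computer search. *)

Notation triple := (nat * nat * nat)%type.

Definition corner (t : triple) (v : nat) : nat :=
  nth 0 [:: t.1.1; t.1.2; t.2] v.

Definition succ3 (v : nat) : nat := nth 0 [:: 1; 2; 0] v.

(** Surjectivity will follow by counting. Arc labels are compared through sums because subtraction
    on [nat] truncates; [side_lt] covers both orders of two corners and so bounds absolute
    differences. *)
Record triangle_labeling (n : nat) (t : nat -> triple) : Prop :=
  TriangleLabeling {
    corner_bounds : forall k v, k < n -> v < 3 -> 0 < corner (t k) v <= 3 * n;
    corner_inj : forall k v l w, k < n -> v < 3 -> l < n -> w < 3 ->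
      corner (t k) v = corner (t l) w -> k = l /\ v = w;
    side_inj : forall k v l w, k < n -> v < 3 -> l < n -> w < 3 ->
      corner (t k) (succ3 v) + corner (t l) w =
      corner (t l) (succ3 w) + corner (t k) v -> k = l /\ v = w;
    side_lt : forall k v w, k < n -> v < 3 -> w < 3 ->
      corner (t k) v < corner (t k) w + (3 * n - 2) }.

(** [s_ j] is the number of exceptional labels below block j; it is the same for
    the last three blocks, of indices 7, 8 and 9. *)
Definition family (s : seq nat) (m q i : nat) : triple :=
  let s_ := nth 0 s in
  nth (0, 0, 0) [::
    (s_ 0 + i + 1, 6 * m + s_ 4 - i, 3 * m + s_ 3 + 2 * i + 1);
    (m + s_ 1 + i + 1, 10 * m + s_ 7 - i, 7 * m + s_ 6 + 2 * i + 2);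
    (10 * m + s_ 7 + i + 1, 3 * m + s_ 2 - i, 3 * m + s_ 3 + 2 * i + 2);
    (11 * m + s_ 7 + i + 1, 7 * m + s_ 5 - i, 7 * m + s_ 6 + 2 * i + 1)] q.

Definition shifts (r : nat) : seq nat :=
  nth [::] [:: [:: 0; 0; 0; 0; 0; 0; 0; 0]; [:: 0; 1; 1; 1; 1; 1; 3; 3];
               [:: 1; 1; 1; 3; 3; 3; 4; 6]; [:: 1; 1; 3; 3; 3; 5; 5; 7]] r.

(** These labels fill the gaps recorded by [shifts r]; for r = 3, the labels 12m + 8 and 12m + 9 lie
    above every block. *)
Definition exceptional (r m : nat) : seq triple :=
  nth [::] [:: [::];
    [:: (m + 1, 7 * m + 2, 7 * m + 3)];
    [:: (1, 7 * m + 4, 3 * m + 2); (3 * m + 3, 9 * m + 5, 9 * m + 6)];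
    [:: (1, 6 * m + 4, 9 * m + 6); (2 * m + 2, 9 * m + 7, 12 * m + 8);
        (2 * m + 3, 12 * m + 9, 6 * m + 5)]] r.

Definition triangle (r m k : nat) : triple :=
  if k < 4 * m then family (shifts r) m (k %/ m) (k %% m)
  else nth (0, 0, 0) (exceptional r m) (k - 4 * m).

(** Once r, q and j are numerals, indices and labels are linear in m and i, and no division is left
    for [lia]. *)
Variant triangle_spec r m : nat -> triple -> Prop :=
  | InFamily q i of q < 4 & i < m :
      triangle_spec r m (q * m + i) (family (shifts r) m q i)
  | Exceptional j of j < r :
      triangle_spec r m (4 * m + j) (nth (0, 0, 0) (exceptional r m) j).

Lemma triangleP r m k : k < 4 * m + r -> triangle_spec r m k (triangle r m k).
Proof.
move=> lt_k; rewrite /triangle; case: ltnP => [lt_k4m | le_4mk].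
  have m_gt0 : 0 < m by lia.
  rewrite [X in triangle_spec _ _ X _](divn_eq k m).
  by apply: InFamily; rewrite ?ltn_mod // ltn_divLR.
by rewrite -{1}(subnKC le_4mk); apply: Exceptional; lia.
Qed.

Lemma triangle_corner_bounds r m k v : r < 4 -> k < 4 * m + r -> v < 3 ->
  0 < corner (triangle r m k) v <= 3 * (4 * m + r).
Proof.
move=> r_lt4 /triangleP tP; case: r r_lt4 tP => [|[|[|[|//]]]] _;
  case=> [[|[|[|[|//]]]] i _ lt_i | [|[|[|j]]] //= _];
  case: v => [|[|[|//]]] _; rewrite /corner /family /=; lia.
Qed.

(** Families 0 and 2 interleave in block 3, families 1 and 3 in block 6. *)
Lemma triangle_corner_inj r m k v l w : r < 4 ->
    k < 4 * m + r -> v < 3 -> l < 4 * m + r -> w < 3 ->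
  corner (triangle r m k) v = corner (triangle r m l) w -> k = l /\ v = w.
Proof.
move=> r_lt4 /triangleP kP v_lt3 /triangleP lP w_lt3.
case: r r_lt4 kP lP => [|[|[|[|//]]]] _;
  case=> [[|[|[|[|//]]]] i _ lt_i | [|[|[|j]]] //= _];
  case: v v_lt3 => [|[|[|//]]] _;
  case=> [[|[|[|[|//]]]] i' _ lt_i' | [|[|[|j']]] //= _];
  case: w w_lt3 => [|[|[|//]]] _; rewrite /corner /family /=; lia.
Qed.

(** In each family the arc labels have slopes -2, 3, -1 in i. Those of slope 3 overlap in range for
    families 0 and 1, and for 2 and 3, but differ modulo 3. The case n = 1 is excluded: the triangle
    1, 2, 3 repeats the difference 1. *)
Lemma triangle_side_inj r m k v l w : r < 4 ->
    1 < 4 * m + r -> k < 4 * m + r -> v < 3 -> l < 4 * m + r -> w < 3 ->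
  corner (triangle r m k) (succ3 v) + corner (triangle r m l) w =
  corner (triangle r m l) (succ3 w) + corner (triangle r m k) v ->
  k = l /\ v = w.
Proof.
move=> r_lt4 n_gt1 /triangleP kP v_lt3 /triangleP lP w_lt3.
case: r r_lt4 n_gt1 kP lP => [|[|[|[|//]]]] _ n_gt1;
  case=> [[|[|[|[|//]]]] i _ lt_i | [|[|[|j]]] //= _];
  case: v v_lt3 => [|[|[|//]]] _;
  case=> [[|[|[|[|//]]]] i' _ lt_i' | [|[|[|j']]] //= _];
  case: w w_lt3 => [|[|[|//]]] _; rewrite /corner /succ3 /family /=; lia.
Qed.

Lemma triangle_side_lt r m k v w :
    r < 4 -> 1 < 4 * m + r -> k < 4 * m + r -> v < 3 -> w < 3 ->
  corner (triangle r m k) v < corner (triangle r m k) w + (3 * (4 * m + r) - 2).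
Proof.
move=> r_lt4 n_gt1 /triangleP tP v_lt3 w_lt3.
case: r r_lt4 n_gt1 tP => [|[|[|[|//]]]] _ n_gt1;
  case=> [[|[|[|[|//]]]] i _ lt_i | [|[|[|j]]] //= _];
  case: v v_lt3 => [|[|[|//]]] _; case: w w_lt3 => [|[|[|//]]] _;
  rewrite /corner /family /=; lia.
Qed.

Lemma triangle_labeling_exists n : 1 < n -> exists t, triangle_labeling n t.
Proof.
move=> n_gt1; have r_lt4 : n %% 4 < 4 by rewrite ltn_mod.
exists (triangle (n %% 4) (n %/ 4)).
rewrite {1}(divn_eq n 4) mulnC; rewrite {1}(divn_eq n 4) mulnC in n_gt1.
split=> *; first exact: triangle_corner_bounds.
- exact: (@triangle_corner_inj (n %% 4) (n %/ 4)).
- exact: (@triangle_side_inj (n %% 4) (n %/ 4)).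
- exact: triangle_side_lt.
Qed.

Lemma arc_copies_dicycle3 n
    (a : vertex (copies n dicycle3) * vertex (copies n dicycle3)) :
  a \in arcs (copies n dicycle3) ->
  a.2.1 = a.1.1 /\ nat_of_ord a.2.2 = succ3 (nat_of_ord a.1.2).
Proof.
case: a => [[i v] [j w]]; rewrite inE /= => /andP[/eqP -> ].
by rewrite !inE => /orP[/orP[]|] /eqP[-> ->].
Qed.

Section LabelingOfTriangles.

Variables (n : nat) (t : nat -> triple).
Hypothesis tP : triangle_labeling n t.

Let V := vertex (copies n dicycle3).

Definition labeling_of (x : V) : nat := corner (t x.1) x.2.

Lemma labeling_of_inj : injective labeling_of.
Proof.
move=> [i v] [j w] /(corner_inj tP (ltn_ord i) (ltn_ord v) (ltn_ord j) (ltn_ord w)).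
by case=> /val_inj /= -> /val_inj /= ->.
Qed.

Lemma labeling_of_bounds x : 1 <= labeling_of x <= #|V|.
Proof.
rewrite card_prod !card_ord mulnC.
exact: (corner_bounds tP (ltn_ord _) (ltn_ord _)).
Qed.

(** An injection between finite sets of equal size is onto. *)
Lemma labeling_of_surj k : 1 <= k <= #|V| -> exists x, labeling_of x = k.
Proof.
move=> k_bounds; pose s := [seq labeling_of x | x <- enum V].
have s_uniq : uniq s by rewrite map_inj_uniq ?enum_uniq //; exact: labeling_of_inj.
have s_sub : {subset s <= iota 1 #|V|}.
  by move=> _ /mapP[x _ ->]; rewrite mem_iota add1n ltnS labeling_of_bounds.
have [|_ sE] := uniq_min_size s_uniq s_sub.
  by rewrite size_iota size_map -cardE.
have : k \in s by rewrite sE mem_iota add1n ltnS.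
by case/mapP=> x _ ->; exists x.
Qed.

Lemma gdl_labeling_of : @gdl (copies n dicycle3) labeling_of.
Proof.
split; first exact: labeling_of_inj.
- move=> k; split=> [[x <-]|]; [exact: labeling_of_bounds | exact: labeling_of_surj].
- move=> [[i v] [i' v']] [[j w] [j' w']] /arc_copies_dicycle3[/= -> v'E].
  move=> /arc_copies_dicycle3[/= -> w'E]; rewrite /arc_label /labeling_of /= => eq_lab.
  have [] := side_inj tP (ltn_ord i) (ltn_ord v) (ltn_ord j) (ltn_ord w).
    by rewrite -v'E -w'E; lia.
  move=> /val_inj -> vw; rewrite (val_inj vw).
  by congr (_, (_, _)); apply: val_inj; rewrite /= v'E w'E vw.
Qed.

Lemma magnitude_labeling_of_lt a : a \in arcs (copies n dicycle3) ->
  @magnitude (copies n dicycle3) labeling_of a < 3 * n - 2.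
Proof.
case: a => [[i v] [i' v']] /arc_copies_dicycle3[/= -> v'E].
have := side_lt tP (ltn_ord i) (ltn_ord v) (ltn_ord v').
have := side_lt tP (ltn_ord i) (ltn_ord v') (ltn_ord v).
by rewrite /magnitude /arc_label /labeling_of /=; lia.
Qed.

End LabelingOfTriangles.

Theorem lemma7 (n : nat) (hn : 2 <= n) :
  exists f : vertex (copies n dicycle3) -> nat,
    [/\ gdl f,
        #|[set a in arcs (copies n dicycle3) | magnitude f a == 3 * n - 2]| <= 1
      & forall a, a \in arcs (copies n dicycle3) ->
          magnitude f a <> 3 * n - 2 -> magnitude f a < 3 * n - 2].
Proof.
have [t tP] := triangle_labeling_exists hn.
exists (@labeling_of n t); split; first exact: gdl_labeling_of.
(* No arc reaches magnitude 3n - 2, so the set is empty. *)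
- rewrite eq_card0 // => a; rewrite inE; apply/negP => /andP[a_arc /eqP mag_a].
  by have := magnitude_labeling_of_lt tP a_arc; rewrite mag_a ltnn.
- by move=> a a_arc _; exact: magnitude_labeling_of_lt.
Qed.
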